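(* Let $k\ge 3$ be an integer, let $u$ be a real number with $1\le u\le \tfrac12 k(k+1)$, and assume that $\mathrm{MC}_k(u)$ holds. Let $t$ be an integer with $1\le t\le k$, and let $\mathbf i=(i_1,\ldots,i_t)$ be a $t$-tuple of integers with $1\le i_1<i_2<\cdots<i_t\le k$. Let $\iota_1<\cdots<\iota_{k-t}$ be the elements of $\{1,\ldots,k\}\setminus\{i_1,\ldots,i_t\}$, and write $\boldsymbol\alpha^*=(\alpha_{i_1},\ldots,\alpha_{i_t})$ and $\boldsymbol\alpha^\dagger=(\alpha_{\iota_1},\ldots,\alpha_{\iota_{k-t}})$. Then there exists a set $\mathfrak B\subseteq[0,1)^{k-t}$ of full (Lebesgue) measure such that, whenever $\boldsymbol\alpha^\dagger\in\mathfrak B$ and $\varepsilon>0$, then for all real numbers $X$ sufficiently large in terms of $\varepsilon$, $k$ and $\boldsymbol\alpha^\dagger$, one has $$\sup_{\boldsymbol\alpha^*\in[0,1)^t}|f_k(\boldsymbol\alpha;X)|\le X^{1/2+\delta(\mathbf i)+\varepsilon},$$ where $$\delta(\mathbf i)=\frac{t+1+2(i_1+\cdots+i_t)}{4u+2t+2}.$$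
   Context: Write $e(z)=e^{2\pi i z}$. For an integer $k\ge 2$, $\boldsymbol\alpha=(\alpha_1,\ldots,\alpha_k)\in\mathbb R^k$ and real $X>0$, put $$f_k(\boldsymbol\alpha;X)=\sum_{1\le x\le X}e(\alpha_1x+\cdots+\alpha_kx^k),$$ the sum being over integers $x$. The assertion $\mathrm{MC}_k(u)$ is that for all real $s$ with $1\le s\le u$ and every $\varepsilon>0$ there is a constant $C=C(k,s,\varepsilon)$ such that for all $X\ge1$, $$\int_{[0,1)^k}|f_k(\boldsymbol\alpha;X)|^{2s}\,d\boldsymbol\alpha\le C X^{\varepsilon}\bigl(X^s+X^{2s-\frac12k(k+1)}\bigr).$$ The point $\boldsymbol\alpha\in[0,1)^k$ is the one assembled from the coordinates in $\boldsymbol\alpha^*$ and $\boldsymbol\alpha^\dagger$. When $t=k$, $[0,1)^{0}$ is a single point of measure $1$. *)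

(* Defs.v *)
From HB Require Import structures.
From mathcomp Require Import all_boot all_order all_algebra.
From mathcomp Require Import complex.
From mathcomp Require Import all_classical all_reals all_analysis.

Set Implicit Arguments.
Unset Strict Implicit.
Unset Printing Implicit Defensive.
Import Order.TTheory GRing.Theory Num.Theory.
Import numFieldNormedType.Exports.
Import Normc.

Local Open Scope classical_set_scope.
Local Open Scope ring_scope.

Section cons_measure.
Local Open Scope ereal_scope.
Context {R : realType} {n : nat}.
Variable m : {sigma_finite_measure set (n.-tuple (measurableTypeR R)) -> \bar R}.

Let cons (p : measurableTypeR R * n.-tuple (measurableTypeR R)) :
  n.+1.-tuple (measurableTypeR R) := [tuple of p.1 :: p.2].

Definition cons_measure : set (n.+1.-tuple (measurableTypeR R)) -> \bar R :=
  pushforward (lebesgue_measure \x m) cons.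

Let measurable_cons_pair : measurable_fun setT cons.
Proof. exact: measurable_cons measurable_fst measurable_snd. Qed.

Let uncons (v : n.+1.-tuple (measurableTypeR R)) :
  measurableTypeR R * n.-tuple (measurableTypeR R) :=
  (thead v, [tuple of behead v]).

Let measurable_uncons : measurable_fun setT uncons.
Proof.
apply: measurable_fun_pair (@measurable_behead _ _ _); exact: measurable_tnth.
Qed.

Let consK : cancel cons uncons.
Proof.
by move=> [x v]; rewrite /uncons /cons/= theadE; congr pair; exact: val_inj.
Qed.

Let unconsK : cancel uncons cons.
Proof. by move=> v; rewrite [RHS]tuple_eta. Qed.

Let cons_measure0 : cons_measure set0 = 0. Proof. exact: measure0. Qed.

Let cons_measure_ge0 A : 0 <= cons_measure A. Proof. exact: measure_ge0. Qed.

Let cons_measure_sigma_additive : semi_sigma_additive cons_measure.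
Proof. exact: measure_semi_sigma_additive. Qed.

HB.instance Definition _ := isMeasure.Build _ _ _ cons_measure
  cons_measure0 cons_measure_ge0 cons_measure_sigma_additive.

Let sigma_finite_cons_measure : sigma_finite setT cons_measure.
Proof.
have /sigma_finiteP[F [FT ndF Foo]] := sigma_finiteT (@lebesgue_measure R).
have /sigma_finiteP[G [GT ndG Goo]] := sigma_finiteT m.
exists (fun i => uncons @^-1` (F i `*` G i)).
  rewrite -preimage_bigcup (_ : \bigcup_i (F i `*` G i) = setT) ?preimage_setT//.
  rewrite -subTset => -[x v] _.
  have [i _ Fix] : (\bigcup_i F i) x by rewrite -FT.
  have [j _ Gjv] : (\bigcup_i G i) v by rewrite -GT.
  exists (maxn i j) => //; split => /=.
    by move: x Fix; exact/subsetPset/ndF/leq_maxl.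
  by move: v Gjv; exact/subsetPset/ndG/leq_maxr.
move=> i; have [mF Fioo] := Foo i; have [mG Gioo] := Goo i; split.
  rewrite -[X in measurable X]setTI.
  by apply: measurable_uncons => //; exact: measurableX.
rewrite /cons_measure /pushforward -comp_preimage.
rewrite (_ : uncons \o cons = id); last exact/funext/consK.
by rewrite preimage_id product_measure1E// lte_mul_pinfty// ge0_fin_numE.
Qed.

HB.instance Definition _ := Measure_isSigmaFinite.Build _ _ _ cons_measure
  sigma_finite_cons_measure.

End cons_measure.

(* n-dimensional Lebesgue measure; a point mass for n = 0 *)
Fixpoint lebesgue_tuple (R : realType) (n : nat) :
    {sigma_finite_measure set (n.-tuple (measurableTypeR R)) -> \bar R} :=
  if n is n'.+1 then cons_measure (lebesgue_tuple R n') else \d_[tuple].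

Lemma lebesgue_tuple_box (R : realType) (n : nat) (A : 'I_n -> set R) :
  (forall j, measurable (A j : set (measurableTypeR R))) ->
  lebesgue_tuple R n [set v | forall j, A j (tnth v j)] =
  (\prod_(j < n) lebesgue_measure (A j))%E.
Proof.
elim: n A => [|n IH] A mA; first by rewrite big_ord0 /= diracE mem_set//= => -[].
rewrite big_ord_recl /= -IH => [|j]; last exact: mA.
rewrite -product_measure1E//; last first.
  rewrite (_ : [set v | _] = \bigcap_j ((fun v => tnth v j) @^-1` A (lift ord0 j))).
    apply: fin_bigcap_measurable => // j _; rewrite -[X in measurable X]setTI.
    exact: measurable_tnth.
  by apply/seteqP; split => v /= Av j; [move=> _|]; exact: Av.
rewrite /cons_measure /pushforward; congr product_measure1.
apply/seteqP; split => -[x v] /=.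
  by move=> Av; split=> [|j]; [exact: (Av ord0)|have := Av (lift ord0 j); rewrite tnthS].
by move=> [Ax Av] j; case: (unliftP ord0 j) => [j' ->|->]; rewrite ?tnthS ?tnth0.
Qed.

Section mean_value.
Context {R : realType}.

Definition unit_cube (n : nat) : set (n.-tuple R) :=
  [set v | forall j, 0 <= tnth v j < 1].
Arguments unit_cube : clear implicits.

(* exp (2 pi i x) for real x *)
Definition unit_exp (x : R) : R[i] := (cos (2 * pi * x) +i* sin (2 * pi * x))%C.

(* The coordinate alpha_(j+1) is tnth alpha j, as ordinals start at 0. *)
Definition weyl_sum (k : nat) (alpha : k.-tuple R) (X : R) : R[i] :=
  \sum_(1 <= x < (Num.truncn X).+1)
    unit_exp (\sum_(j < k) tnth alpha j * x%:R ^+ j.+1).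

Definition MC (k : nat) (u : R) : Prop :=
  forall s : R, 1 <= s <= u -> forall eps : R, 0 < eps ->
  exists C : R, forall X : R, 1 <= X ->
  (\int[lebesgue_tuple R k]_(alpha in unit_cube k)
      (normc (weyl_sum alpha X) `^ (2 * s))%:E
   <= (C * X `^ eps * (X `^ s + X `^ (2 * s - (k * k.+1)%:R / 2)))%:E)%E.

(* the increasing enumeration of {1, ..., k} minus i *)
Definition complement (k : nat) (i : seq nat) : seq nat :=
  [seq j <- iota 1 k | j \notin i].

(* The point alpha with alpha_(i_j) the j-th entry of a and alpha_(iota_j) the
   j-th entry of b, where iota = complement k i; the indices in i and iota are
   values in {1, ..., k}. *)
Definition assemble (k t : nat) (i : t.-tuple nat)
    (a : t.-tuple R) (b : (k - t).-tuple R) : k.-tuple R :=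
  [tuple if l.+1 \in i then nth 0 a (index l.+1 i)
         else nth 0 b (index l.+1 (complement k i)) | l < k].

Definition delta (t : nat) (i : t.-tuple nat) (u : R) : R :=
  (t%:R + 1 + 2 * (\sum_(j < t) tnth i j)%:R) / (4 * u + 2 * t%:R + 2).

End mean_value.
Arguments unit_cube {R} n.

Lemma size_complement (k t : nat) (i : t.-tuple nat) :
  sorted ltn i -> (forall j, 1 <= tnth i j <= k)%N ->
  size (complement k i) = (k - t)%N.
Proof.
move=> si ik.
have ui : uniq i by apply: sorted_uniq si; [exact: ltn_trans|exact: ltnn].
have it : size [seq x <- iota 1 k | x \in i] = t.
  rewrite -[RHS](size_tuple i); apply/perm_size; apply: uniq_perm => //.
    by rewrite filter_uniq ?iota_uniq.
  move=> x; rewrite mem_filter mem_iota /=; case: (boolP (x \in i)) => //=.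
  by move=> /tnthP[j ->]; rewrite add1n ltnS ik.
have := count_predC [in i] (iota 1 k); rewrite size_iota -!size_filter.
by rewrite it => /(congr1 (subn^~ t)); rewrite addKn => <-.
Qed.

Lemma assemble_in (R : realType) (k t : nat) (i : t.-tuple nat)
    (a : t.-tuple R) (b : (k - t).-tuple R) (j : 'I_t) (l : 'I_k) :
  sorted ltn i -> l.+1 = tnth i j -> tnth (assemble i a b) l = tnth a j.
Proof.
move=> si lj; rewrite tnth_mktuple lj mem_tnth.
have ui : uniq i by apply: sorted_uniq si; [exact: ltn_trans|exact: ltnn].
by rewrite (tnth_nth 0%N) index_uniq ?size_tuple// (tnth_nth 0).
Qed.

Lemma assemble_notin (R : realType) (k t : nat) (i : t.-tuple nat)
    (a : t.-tuple R) (b : (k - t).-tuple R) (j : 'I_(k - t)) (l : 'I_k) :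
  sorted ltn i -> (forall j, 1 <= tnth i j <= k)%N ->
  l.+1 = nth 0%N (complement k i) j -> tnth (assemble i a b) l = tnth b j.
Proof.
move=> si ik lj.
have jc : (j < size (complement k i))%N by rewrite size_complement.
have : nth 0%N (complement k i) j \in complement k i by exact: mem_nth.
rewrite mem_filter -lj tnth_mktuple => /andP[/negbTE -> _].
by rewrite lj index_uniq ?filter_uniq ?iota_uniq// (tnth_nth 0).
Qed.

(* Main.v *)
(* Write D = 1/2 + delta + eps and sigma = i_1 + ... + i_t.  If |f(a, b; N)|
   exceeds N ^ D, then |f(a', b; N')| is at least N ^ D / 2 whenever
   N <= N' <= N + N ^ D / 4 and |a'_j - a_j| is at most a small multiple of
   N ^ (D - 1 - i_j).  A weighted sum over N' of w_N' times the 2u-th moment of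
   f( . , b; N') over the unit cube is then at least a constant multiple of
   w_N N ^ ((2u + t + 1) D - t - sigma).  Taking w_N to be N ^ eps divided by
   that power of N makes this N ^ eps, while the mean value hypothesis and
   (2u + t + 1) delta = (t + 1) / 2 + sigma make the integral over b of the
   whole series converge.  So for almost every b the series is finite, which
   bounds the N admitting a large value.  Summing over the lengths N' near N,
   rather than keeping N alone, is what costs the extra 1 in 2u + t + 1. *)

Require Import Defs.
From HB Require Import structures.
From mathcomp Require Import all_boot all_order all_algebra.
From mathcomp Require Import complex.
From mathcomp Require Import all_classical all_reals all_analysis.
From mathcomp Require Import measurable_realfun.
From mathcomp Require Import ring lra.

Set Implicit Arguments.
Unset Strict Implicit.
Unset Printing Implicit Defensive.
Import Order.TTheory GRing.Theory Num.Theory.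
Import numFieldNormedType.Exports.
Import Normc.

Local Open Scope classical_set_scope.
Local Open Scope ring_scope.

(** * Lipschitz bounds for Weyl sums in the length and in the coefficients *)

Section weyl_sum_bounds.
Context {R : realType}.
Implicit Types (x y : R) (k N M : nat).

Lemma normc_triangle (z w : R[i]) : normc (z + w) <= normc z + normc w.
Proof. exact: le_normcD. Qed.

Lemma normc_sum_le (s : seq nat) (F : nat -> R[i]) :
  normc (\sum_(n <- s) F n) <= \sum_(n <- s) normc (F n).
Proof.
elim: s => [|n s IH]; first by rewrite !big_nil normc0.
by rewrite !big_cons (le_trans (normc_triangle _ _))// lerD2l.
Qed.

Lemma normc_le_Re_Im (a b : R) : normc (a +i* b)%C <= `|a| + `|b|.
Proof.
rewrite /normc -[leRHS]ger0_norm ?addr_ge0// -sqrtr_sqr ler_sqrt ?sqr_ge0//.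
rewrite sqrrD !real_normK ?num_real//.
have : 0 <= `|a| * `|b| by rewrite mulr_ge0.
lra.
Qed.

Lemma dist_bounded_derive (f df : R -> R) x y :
  (forall z : R, is_derive z 1 f (df z)) -> (forall z, `|df z| <= 1) ->
  `|f x - f y| <= `|x - y|.
Proof.
move=> fdf df1; wlog yx : x y / y <= x.
  move=> wlg; have [/wlg//|/ltW/wlg] := leP y x.
  by rewrite distrC (distrC x).
have cf : continuous f.
  move=> z; apply: differentiable_continuous; apply/derivable1_diffP.
  exact: (@ex_derive _ _ _ _ _ _ _ (fdf z)).
have [c _ ->] :=
  MVT_segment yx (fun z _ => fdf z) (continuous_subspaceT cf).
by rewrite normrM ler_piMl.
Qed.

Lemma normc_unit_exp x : normc (unit_exp x) = 1.
Proof. by rewrite /normc/= cos2Dsin2 sqrtr1. Qed.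

(** The mean value theorem bounds the real and the imaginary part by [2 * pi * |x - y|] each, whence
    the factor 4. *)
Lemma normc_unit_expB x y :
  normc (unit_exp x - unit_exp y) <= 4 * pi * `|x - y|.
Proof.
apply: (le_trans (normc_le_Re_Im _ _)).
have two_pi : `|2 * pi * x - 2 * pi * y| = 2 * pi * `|x - y|.
  by rewrite -mulrBr normrM ger0_norm// mulr_ge0// pi_ge0.
have -> : 4 * pi * `|x - y| = 2 * pi * `|x - y| + 2 * pi * `|x - y| by lra.
rewrite -two_pi lerD//.
- apply: (dist_bounded_derive (df := fun z => - sin z)) => // z.
  by rewrite normrN ler_norml sin_geN1 sin_le1.
- apply: (dist_bounded_derive (df := cos)) => // z.
  by rewrite ler_norml cos_geN1 cos_le1.
Qed.

Lemma weyl_sum_truncn k (alpha : k.-tuple R) x :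
  weyl_sum alpha x = weyl_sum alpha (Num.truncn x)%:R.
Proof. by rewrite /weyl_sum natrK. Qed.

Lemma normc_weyl_sum_subl k (alpha : k.-tuple R) N M : (N <= M)%N ->
  normc (weyl_sum alpha M%:R - weyl_sum alpha N%:R) <= M%:R - N%:R.
Proof.
move=> NM; rewrite /weyl_sum !natrK (big_cat_nat (n := N.+1))//=.
rewrite addrAC subrr add0r (le_trans (normc_sum_le _ _))//.
under eq_bigr do rewrite normc_unit_exp.
by rewrite sumr_const_nat subSS natrB.
Qed.

Lemma normc_weyl_sum_le k (alpha : k.-tuple R) N :
  normc (weyl_sum alpha N%:R) <= N%:R.
Proof.
have := normc_weyl_sum_subl alpha (leq0n N).
by rewrite [weyl_sum alpha 0%:R]big_geq ?subr0// natrK.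
Qed.

Lemma normc_weyl_sum_subr k (alpha beta : k.-tuple R) N :
  normc (weyl_sum alpha N%:R - weyl_sum beta N%:R) <=
  4 * pi * N%:R * \sum_(j < k) `|tnth alpha j - tnth beta j| * N%:R ^+ j.+1.
Proof.
rewrite /weyl_sum natrK -sumrB (le_trans (normc_sum_le _ _))//.
have -> : 4 * pi * N%:R *
    \sum_(j < k) `|tnth alpha j - tnth beta j| * N%:R ^+ j.+1 =
  \sum_(1 <= x < N.+1) 4 * pi *
    \sum_(j < k) `|tnth alpha j - tnth beta j| * N%:R ^+ j.+1.
  by rewrite sumr_const_nat subSS subn0 -[RHS]mulr_natr [LHS]mulrAC.
rewrite big_seq [leRHS]big_seq ler_sum// => x.
rewrite mem_index_iota => /andP[_ xN].
rewrite (le_trans (normc_unit_expB _ _))// ler_wpM2l ?mulr_ge0 ?pi_ge0//.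
rewrite -sumrB (le_trans (ler_norm_sum _ _ _))// ler_sum// => j _.
rewrite -mulrBl normrM ler_wpM2l// ger0_norm ?exprn_ge0//.
by rewrite ler_pXn2r ?nnegrE// ler_nat.
Qed.

End weyl_sum_bounds.

(** * Measures on tuples are determined by boxes *)

Section tuple_measure.
Context {R : realType}.
Local Notation mR := (measurableTypeR R).

Definition tuple_box (n : nat) (A : 'I_n -> set R) : set (n.-tuple R) :=
  [set v | forall j, A j (tnth v j)].

Lemma measurable_tuple_box n (A : 'I_n -> set R) :
  (forall j, measurable (A j : set mR)) ->
  measurable (tuple_box A : set (n.-tuple mR)).
Proof.
move=> mA.
rewrite (_ : tuple_box A = \bigcap_j ((fun v => tnth v j) @^-1` A j)).
  apply: fin_bigcap_measurable => // j _; rewrite -[X in measurable X]setTI.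
  exact: measurable_tnth.
by apply/seteqP; split => v /= Av j; [move=> _|]; exact: Av.
Qed.

(** The sigma-algebra on tuples is generated by preimages under coordinate maps, and each of these
    is a box whose other sides are the whole line. *)
Lemma measurable_tuple_boxE n : @measurable _ (n.-tuple mR) =
  <<s [set B | exists2 A : 'I_n -> set R,
                 (forall j, measurable (A j : set mR)) & B = tuple_box A] >>.
Proof.
apply/seteqP; split; last first.
  apply: smallest_sub; first exact: sigma_algebra_measurable.
  by move=> _ [A mA ->]; exact: measurable_tuple_box.
apply: smallest_sub; first exact: smallest_sigma_algebra.
apply: (big_ind (fun S => S `<=` _)) => //.
- by move=> S1 S2 S1S S2S B [/S1S|/S2S].
- move=> j _ _ [A mA <-]; apply: sub_sigma_algebra.
  exists (fun l => if l == j then A else setT) => [l|]; first by case: ifP.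
  apply/seteqP; split => v /=.
    by move=> [_ Av] l; case: eqP => // ->.
  by move=> /(_ j); rewrite eqxx; split.
Qed.

(** Boxes are closed under intersection and generate, and the cubes with sides [[- l, l]], of finite
    measure, exhaust the space. *)
Lemma tuple_measure_unique n (m1 m2 : {measure set (n.-tuple mR) -> \bar R}) :
  (forall A : 'I_n -> set R, (forall j, measurable (A j : set mR)) ->
    m1 (tuple_box A) = m2 (tuple_box A)) ->
  (forall r : R, (m1 (tuple_box (fun _ => `[(- r)%R, r]%classic)) < +oo)%E) ->
  forall B, measurable B -> m1 B = m2 B.
Proof.
move=> m12 m1oo B mB.
apply: (@measure_unique _ R (n.-tuple mR) _ (fun l : nat =>
  tuple_box (fun=> `[- l%:R, l%:R]%classic)) (measurable_tuple_boxE n) _ _ _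
  m1 m2 _ _ B mB) => //.
- move=> _ _ [A mA ->] [A' mA' ->]; exists (fun j => A j `&` A' j).
    by move=> j; exact: measurableI.
  apply/seteqP; split => v /=; first by move=> [Av A'v] j; split.
  by move=> AA'; split => j; have [] := AA' j.
- by move=> l; eexists; last reflexivity.
- rewrite -subTset => v _; exists (Num.truncn (\sum_j `|tnth v j|)).+1 => //.
  move=> j /=; rewrite in_itv/= -ler_norml.
  rewrite (@le_trans _ _ (\sum_j `|tnth v j|))//.
    by rewrite (bigD1 j)//= lerDl sumr_ge0.
  exact/ltW/truncnS_gt.
- by move=> _ [A mA ->]; exact: m12.
Qed.

End tuple_measure.
Lemma lebesgue_tuple_boxE (R : realType) n (A : 'I_n -> set R) :
  (forall j, measurable (A j : set (measurableTypeR R))) ->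
  lebesgue_tuple R n (tuple_box A) = (\prod_(j < n) lebesgue_measure (A j))%E.
Proof. exact: lebesgue_tuple_box. Qed.

Lemma unit_cubeE (R : realType) n :
  @unit_cube R n = tuple_box (fun=> `[0, 1[%classic).
Proof.
by apply/seteqP; split => v /= vx j; have := vx j; rewrite /= in_itv.
Qed.

Lemma measurable_unit_cube (R : realType) n :
  measurable (unit_cube n : set (n.-tuple (measurableTypeR R))).
Proof. by rewrite unit_cubeE; exact: measurable_tuple_box. Qed.

(** * Splitting points and Lebesgue measure into the coordinates in [i] and the others *)

Section assemble_coordinates.
Context {R : realType} (k t : nat) (i : t.-tuple nat).
Hypotheses (tk : (t <= k)%N) (i_sorted : sorted ltn i).
Hypothesis i_bounded : forall j, (1 <= tnth i j <= k)%N.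

(** Replaces the [nth] and [index] of [assemble] by two index maps that together reach all [k]
    positions; later arguments on assembled points go through these maps. *)
Lemma assemble_coordinates :
  exists (li : 'I_t -> 'I_k) (lc : 'I_(k - t) -> 'I_k),
  [/\ forall j, (li j).+1 = tnth i j,
      forall (a : t.-tuple R) b j, tnth (assemble i a b) (li j) = tnth a j,
      forall (a : t.-tuple R) b j, tnth (assemble i a b) (lc j) = tnth b j
    & forall l, (exists j, l = li j) \/ (exists j, l = lc j)].
Proof.
(* Entries of [i] and of its complement lie in {1, ..., k} while ordinals start at 0, hence the
   predecessors. *)
have pred_ltn m : (1 <= m <= k)%N -> (m.-1 < k)%N by case: m.
have scomp : size (complement k i) = (k - t)%N by exact: size_complement.
have li_ltn j : ((tnth i j).-1 < k)%N by exact: pred_ltn.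
have lc_bounds j : (j < k - t)%N -> (1 <= nth 0 (complement k i) j <= k)%N.
  rewrite -scomp => /(mem_nth 0%N).
  by rewrite mem_filter mem_iota add1n ltnS => /andP[].
have lc_ltn (j : 'I_(k - t)) : ((nth 0 (complement k i) j).-1 < k)%N.
  exact/pred_ltn/lc_bounds/ltn_ord.
exists (fun j => Ordinal (li_ltn j)), (fun j => Ordinal (lc_ltn j)).
have liS j : (Ordinal (li_ltn j)).+1 = tnth i j.
  by rewrite /= prednK//; case/andP: (i_bounded j).
split => //.
- by move=> a b j; exact: assemble_in.
- move=> a b j; apply: assemble_notin => //=.
  by rewrite prednK//; case/andP: (lc_bounds j (ltn_ord j)).
- move=> l; case: (boolP (l.+1 \in i)) => [/tnthP[j lj]|li].
    by left; exists j; apply/val_inj => /=; rewrite -lj.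
  have lc : l.+1 \in complement k i.
    by rewrite mem_filter li mem_iota /= add1n ltnS ltn_ord.
  right; have jlt : (index l.+1 (complement k i) < k - t)%N.
    by rewrite -scomp index_mem.
  by exists (Ordinal jlt); apply/val_inj; rewrite /= nth_index.
Qed.

End assemble_coordinates.

Section assemble_measure.
Context {R : realType} (k t : nat) (i : t.-tuple nat).
Hypotheses (tk : (t <= k)%N) (i_sorted : sorted ltn i).
Hypothesis i_bounded : forall j, (1 <= tnth i j <= k)%N.
Local Notation mR := (measurableTypeR R).

(** The pair has [b] first, so that [a] is the inner variable of the iterated integral. *)
Let phi (p : (k - t).-tuple mR * t.-tuple mR) : k.-tuple mR :=
  assemble i p.2 p.1.

Lemma measurable_assemble : measurable_fun setT phi.
Proof.
have [li [lc [_ Eli Elc li_lc]]] :=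
  assemble_coordinates (R := R) i_sorted i_bounded.
apply/measurable_fun_tnthP => l.
have [[j ->]|[j ->]] := li_lc l.
  rewrite (_ : _ \o _ = (tnth (T:=mR))^~ j \o snd); last first.
    by apply/funext => -[b a]; exact: Eli.
  by apply: measurableT_comp => //; exact: measurable_tnth.
rewrite (_ : _ \o _ = (tnth (T:=mR))^~ j \o fst); last first.
  by apply/funext => -[b a]; exact: Elc.
by apply: measurableT_comp => //; exact: measurable_tnth.
Qed.

(** By uniqueness it is enough to compare boxes. The preimage of a box is a product of two boxes, so
    both sides multiply the same [k] side lengths in different orders. *)
Lemma lebesgue_tuple_assemble (B : set (k.-tuple mR)) : measurable B ->
  lebesgue_tuple R k B =
  pushforward (lebesgue_tuple R (k - t) \x lebesgue_tuple R t)%E phi B.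
Proof.
have [li [lc [_ Eli Elc li_lc]]] :=
  assemble_coordinates (R := R) i_sorted i_bounded.
pose phi_mfun : {mfun _ >-> _} :=
  HB.pack phi (isMeasurableFun.Build _ _ _ _ _ measurable_assemble).
apply: (tuple_measure_unique (m2 := pushforward
  (lebesgue_tuple R (k - t) \x lebesgue_tuple R t)%E phi_mfun)); last first.
  move=> r.
  apply: (eq_ind_r (fun x => x < +oo)%E _ (lebesgue_tuple_boxE _)) => //.
  rewrite (eq_bigr (fun=> (fine (lebesgue_measure `[(- r)%R, r]%classic))%:E)).
    by rewrite prodEFin ltry.
  by move=> j _; rewrite fineK// lebesgue_measure_itv/=; case: ifPn.
move=> A mA; rewrite /pushforward.
have box_preimage : phi_mfun @^-1` tuple_box A =
    tuple_box (A \o lc) `*` tuple_box (A \o li).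
  apply/seteqP; split => -[b a] /=.
    by move=> Aba; split => j /=; [have := Aba (lc j)|have := Aba (li j)];
      rewrite /phi ?Eli ?Elc.
  move=> [Ab Aa] l; have [[j ->]|[j ->]] := li_lc l.
    by rewrite /phi/= Eli; exact: Aa.
  by rewrite /phi/= Elc; exact: Ab.
transitivity (\prod_l lebesgue_measure (A l))%E.
  exact: lebesgue_tuple_boxE.
transitivity ((\prod_j lebesgue_measure ((A \o lc) j)) *
              (\prod_j lebesgue_measure ((A \o li) j)))%E; last first.
  transitivity ((lebesgue_tuple R (k - t) \x lebesgue_tuple R t)%E
    (tuple_box (A \o lc) `*` tuple_box (A \o li))); last first.
    by congr (product_measure1 _ _ _).
  symmetry; etransitivity.
    by apply: product_measure1E; apply: measurable_tuple_box => j; exact: mA.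
  by congr (_ * _)%E; apply: lebesgue_tuple_boxE => j; exact: mA.
(* This list reaches all [k] positions and has length [k], so it has no repetitions. *)
pose s := [seq lc j | j <- enum 'I_(k - t)] ++ [seq li j | j <- enum 'I_t].
have s_enum : perm_eq (enum 'I_k) s.
  have enum_s : {subset enum 'I_k <= s}.
    move=> l _; rewrite mem_cat; apply/orP.
    by have [[j ->]|[j ->]] := li_lc l; [right|left];
      rewrite map_f// mem_enum.
  have s_size : (size s <= size (enum 'I_k))%N.
    by rewrite size_cat 2!size_map -!cardE !card_ord subnK.
  apply: uniq_perm => //; first exact: enum_uniq.
    by apply: leq_size_uniq enum_s s_size; exact: enum_uniq.
  by move=> l; rewrite mem_enum enum_s ?mem_enum.
by rewrite -[LHS]big_enum (perm_big _ s_enum)/= big_cat 2!big_map 2!big_enum.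
Qed.

(** Change of variables along [phi], then Tonelli. *)
Lemma integral_assemble (f : k.-tuple mR -> \bar R) :
  measurable_fun setT f -> (forall x, (0 <= f x)%E) ->
  (\int[lebesgue_tuple R k]_(x in unit_cube k) f x =
   \int[lebesgue_tuple R (k - t)]_(b in unit_cube (k - t))
     \int[lebesgue_tuple R t]_(a in unit_cube t) f (assemble i a b))%E.
Proof.
have mcube n := @measurable_unit_cube R n.
move=> mf f0.
have [li [lc [_ Eli Elc li_lc]]] :=
  assemble_coordinates (R := R) i_sorted i_bounded.
pose phi_mfun : {mfun _ >-> _} :=
  HB.pack phi (isMeasurableFun.Build _ _ _ _ _ measurable_assemble).
rewrite (eq_measure_integral (pushforward
  (lebesgue_tuple R (k - t) \x lebesgue_tuple R t)%E phi_mfun)); last first.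
  by move=> B mB _; exact: lebesgue_tuple_assemble.
rewrite (ge0_integral_pushforward measurable_assemble _ (mcube k));
  last 2 first.
- exact: measurable_funTS.
- by move=> x _; exact: f0.
have -> : phi_mfun @^-1` unit_cube k = unit_cube (k - t) `*` unit_cube t.
  apply/seteqP; split => -[b a] /=.
    by move=> Aba; split => j /=; [have := Aba (lc j)|have := Aba (li j)];
      rewrite /phi ?Eli ?Elc.
  move=> [Ab Aa] l; have [[j ->]|[j ->]] := li_lc l.
    by rewrite /phi/= Eli; exact: Aa.
  by rewrite /phi/= Elc; exact: Ab.
rewrite integral_mkcond fubini_tonelli1; first last.
- by move=> x; apply: erestrict_ge0 => y _; exact: f0.
- apply/(measurable_restrictT _ _).1; first by apply: measurableX; exact: mcube.
  apply: measurable_funTS; apply: measurableT_comp => //.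
  exact: measurable_assemble.
rewrite [RHS]integral_mkcond; apply: eq_integral => b _.
rewrite patchE /fubini_F; case: ifPn => [|/negP] bcube.
  rewrite [RHS]integral_mkcond; apply: eq_integral => a _.
  by rewrite !patchE in_setX bcube.
apply: integral0_eq => a _; rewrite patchE in_setX.
by move/negP/negbTE: bcube => ->.
Qed.

Lemma measurable_integral_assemble (f : k.-tuple mR -> \bar R) :
  measurable_fun setT f -> (forall x, (0 <= f x)%E) ->
  measurable_fun setT (fun b : (k - t).-tuple mR =>
    (\int[lebesgue_tuple R t]_(a in unit_cube t) f (assemble i a b))%E).
Proof.
move=> mf f0.
(* Extension by zero off the cube in [a] turns the function into an inner Tonelli integral over the
   whole space. *)
pose g := (f \o phi) \_ (setT `*` unit_cube t).
rewrite (_ : (fun b => _) = fubini_F (lebesgue_tuple R t) g).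
  apply: measurable_fun_fubini_tonelli_F => [|x]; last first.
    by apply: erestrict_ge0 => y _; exact: f0.
  apply/(measurable_restrictT _ _).1.
    by apply: measurableX => //; exact: measurable_unit_cube.
  apply: measurable_funTS; apply: measurableT_comp => //.
  exact: measurable_assemble.
apply/funext => b; rewrite /fubini_F [LHS]integral_mkcond.
by apply: eq_integral => a _; rewrite /g !patchE in_setX in_setT.
Qed.

End assemble_measure.

(** * Moments over fibres and almost everywhere finiteness of their weighted series *)

Section moments.
Context {R : realType}.
Local Notation mR := (measurableTypeR R).

Lemma sum_unit_exp (s : seq nat) (theta : nat -> R) :
  \sum_(x <- s) unit_exp (theta x) =
  ((\sum_(x <- s) cos (2 * pi * theta x)) +i*
   (\sum_(x <- s) sin (2 * pi * theta x)))%C.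
Proof.
elim: s => [|x s IH]; first by rewrite !big_nil.
by rewrite !big_cons IH.
Qed.

Lemma measurable_normc_weyl_sum k (X : R) :
  measurable_fun setT (fun alpha : k.-tuple mR => normc (weyl_sum alpha X)).
Proof.
pose theta x (alpha : k.-tuple mR) := 2 * pi *
  (\sum_(j < k) tnth alpha j * x%:R ^+ j.+1).
have mtheta x : measurable_fun setT (theta x).
  apply: measurable_funM => //; apply: measurable_sum => j.
  by apply: measurable_funM => //; exact: measurable_tnth.
rewrite (_ : (fun alpha => _) = (fun alpha => Num.sqrt
  ((\sum_(1 <= x < (Num.truncn X).+1) cos (theta x alpha)) ^+ 2 +
   (\sum_(1 <= x < (Num.truncn X).+1) sin (theta x alpha)) ^+ 2))); last first.
  by apply/funext => alpha; rewrite /weyl_sum sum_unit_exp.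
apply: measurableT_comp.
  by apply: continuous_measurable_fun; exact: sqrt_continuous.
apply: measurable_funD; apply: measurable_funX; apply: measurable_sum => x.
- apply: measurableT_comp => //.
  by apply: continuous_measurable_fun; exact: continuous_cos.
- apply: measurableT_comp => //.
  by apply: continuous_measurable_fun; exact: continuous_sin.
Qed.

Definition fiber_moment (k t : nat) (i : t.-tuple nat) (p : R)
    (b : (k - t).-tuple R) (N : nat) : \bar R :=
  (\int[lebesgue_tuple R t]_(a in unit_cube t)
     (normc (weyl_sum (assemble i a b) N%:R) `^ p)%:E)%E.

Lemma fiber_moment_ge0 k t i p b N : (0 <= @fiber_moment k t i p b N)%E.
Proof. by apply: integral_ge0 => a _; rewrite lee_fin powR_ge0. Qed.

(** By Tonelli the integral over [b] of the fibre series is the series of full moments, assumed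
    finite; an integrable function is finite almost everywhere. *)
Lemma negligible_infinite_fiber_series k t (i : t.-tuple nat) (p : R)
    (w : nat -> R) :
  (t <= k)%N -> sorted ltn i -> (forall j, (1 <= tnth i j <= k)%N) ->
  (forall N, 0 <= w N) ->
  (\sum_(0 <= n <oo) (w n)%:E * \int[lebesgue_tuple R k]_(alpha in unit_cube k)
    (normc (weyl_sum alpha n.+1%:R) `^ p)%:E < +oo)%E ->
  (lebesgue_tuple R (k - t)).-negligible (unit_cube (k - t) `\`
    [set b | (\sum_(0 <= n <oo) (w n)%:E * fiber_moment i p b n.+1 < +oo)%E]).
Proof.
move=> tk si ik w0 wfin.
pose f n (alpha : k.-tuple mR) := (normc (weyl_sum alpha n.+1%:R) `^ p)%:E.
have mf n : measurable_fun setT (f n).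
  apply/measurable_EFinP; apply: measurableT_comp (measurable_powR p) _.
  exact: measurable_normc_weyl_sum.
have f0 n x : (0 <= f n x)%E by rewrite lee_fin powR_ge0.
have mF n : measurable_fun setT
    (fun b : (k - t).-tuple mR => fiber_moment i p b n.+1).
  exact: (measurable_integral_assemble si ik (mf n) (f0 n)).
pose G (b : (k - t).-tuple mR) :=
  (\sum_(0 <= n <oo) (w n)%:E * fiber_moment i p b n.+1)%E.
have wF0 n b : (0 <= (w n)%:E * fiber_moment i p b n.+1)%E.
  by rewrite mule_ge0 ?lee_fin// fiber_moment_ge0.
have mwF n : measurable_fun (unit_cube (k - t) : set ((k - t).-tuple mR))
    (fun b : (k - t).-tuple mR => (w n)%:E * fiber_moment i p b n.+1)%E.
  by apply: measurable_funTS; exact: measurable_funeM.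
have mcube := @measurable_unit_cube R (k - t).
have G0 b : (0 <= G b)%E by exact: nneseries_ge0.
have mG : measurable_fun (unit_cube (k - t) : set ((k - t).-tuple mR)) G.
  by apply: ge0_emeasurable_sum.
have intG : (lebesgue_tuple R (k - t)).-integrable (unit_cube (k - t)) G.
  apply/integrableP; split => //.
  under eq_integral do rewrite gee0_abs//.
  rewrite integral_nneseries//.
  apply: le_lt_trans wfin; apply: lee_nneseries => n _.
    by move=> _; apply: integral_ge0 => b _; exact: wF0.
  rewrite ge0_integralZl//; last 3 first.
  - exact: measurable_funTS.
  - by move=> b _; exact: fiber_moment_ge0.
  - by rewrite lee_fin.
  by rewrite (integral_assemble tk si ik (mf n) (f0 n)).
apply: negligibleS (integrable_ae mcube intG).
move=> b [bcube /= /negP Gb].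
by move=> /(_ bcube) Gfin; move/negP: Gb; apply; rewrite ltey_eq Gfin.
Qed.

End moments.

(** * Negative powers and the series of [n ^ (- 1 - eps)] *)

Lemma powR_neg_le (R : realType) (x y e : R) : 0 < x -> x <= y -> e <= 0 ->
  y `^ e <= x `^ e.
Proof.
move=> x0 xy e0; have y0 : 0 < y by exact: lt_le_trans xy.
rewrite -[e]opprK !(powRN _ (- e)) lef_pV2 ?posrE ?powR_gt0//.
by rewrite ge0_ler_powR ?nnegrE ?oppr_ge0// ltW.
Qed.

(* Comparison with the telescoping series of [n ^ (- eps)]. *)
Lemma powR_series_le (R : realType) (eps : R) (n : nat) : 0 < eps ->
  \sum_(0 <= m < n) m.+1%:R `^ (- 1 - eps) <= 1 + eps^-1.
Proof.
move=> eps0.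
have step m : m.+2%:R `^ (- 1 - eps) <=
    eps^-1 * (m.+1%:R `^ (- eps) - m.+2%:R `^ (- eps)) :> R.
  (* The difference of powers on the right is [eps * c ^ (- eps - 1)] for some [c] below [m + 2],
     and negative powers decrease. *)
  have [|||c] := @MVT_segment R (fun x => x `^ (- eps))
      (fun x => - eps * x `^ (- eps - 1)) m.+1%:R m.+2%:R;
    first by rewrite ler_nat.
  - move=> x; rewrite in_itv/= => /andP[mx _].
    by apply: is_derive1_powR; apply: lt_trans mx; rewrite ltr0n.
  - apply: derivable_within_continuous => x; rewrite in_itv/= => /andP[mx _].
    apply: derivable_powR; rewrite in_itv/= andbT.
    by apply: lt_le_trans mx; rewrite ltr0n.
  rewrite in_itv/= => /andP[mc cm].
  rewrite -natrB// subSnn mulr1 /= => E.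
  rewrite -[X in _ * X]opprB E mulNr opprK mulrA mulVf ?gt_eqF// mul1r.
  rewrite [- eps - 1]addrC.
  apply: powR_neg_le => //; first by apply: lt_le_trans mc; rewrite ltr0n.
  lra.
case: n => [|n]; first by rewrite big_geq// addr_ge0// invr_ge0 ltW.
rewrite big_nat_recl// powR1 lerD2l//.
apply: (@le_trans _ _ (\sum_(0 <= m < n)
    eps^-1 * (m.+1%:R `^ (- eps) - m.+2%:R `^ (- eps)))).
  by apply: ler_sum => m _; exact: step.
rewrite -mulr_sumr ler_piMr ?invr_ge0 ?(ltW eps0)//.
under eq_bigr do rewrite -opprB.
rewrite sumrN telescope_sumr// opprB powR1 lerBlDr lerDl powR_ge0//.
Qed.

(** * Persistence of large values under small changes *)

Lemma unit_subinterval (R : realType) (a eta : R) :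
  0 <= a < 1 -> 0 < eta <= 2^-1 ->
  exists c, 0 <= c /\ c + eta <= 1 /\
    forall x, c <= x < c + eta -> `|x - a| <= eta.
Proof.
move=> /andP[a0 a1] /andP[eta0 eta2].
(* A one-sided neighbourhood of [a] is used, to the right if [a <= 1/2] and to the left otherwise;
   as [eta <= 1/2], it stays in the unit interval. *)
have [a2|a2] := leP a 2^-1.
  exists a; split => //; split; first by lra.
  by move=> x /andP[xa xae]; rewrite ler_norml; apply/andP; split; lra.
exists (a - eta); split; [by lra|split; first by lra].
by move=> x /andP[xa xae]; rewrite ler_norml; apply/andP; split; lra.
Qed.

Section block.
Context {R : realType}.
Local Notation mR := (measurableTypeR R).

(* The perturbation of each [alpha_m] by at most [perturbation k * r / N ^ m]
   changes a Weyl sum of length at most [2 N] by at most [r * N / 4]. *)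
Definition perturbation (k : nat) : R := (32 * pi * k%:R * 2 ^+ k)^-1.

Lemma perturbation_gt0 k : (0 < k)%N -> 0 < perturbation k.
Proof. by move=> k0; rewrite invr_gt0 !mulr_gt0 ?pi_gt0 ?ltr0n ?exprn_gt0. Qed.

Lemma perturbation_le k : (0 < k)%N -> perturbation k <= 2^-1.
Proof.
move=> k0; have k1 : 1 <= k%:R :> R by rewrite ler1n.
have pk : 1 <= 2 ^+ k :> R by rewrite exprn_ege1// ler1n.
have p2 := pi_ge2 R.
rewrite lef_pV2 ?posrE ?mulr_gt0 ?exprn_gt0//; try lra.
have h : 1 <= pi * k%:R :> R by rewrite mulr_ege1//; lra.
have : 1 <= pi * k%:R * 2 ^+ k :> R by rewrite mulr_ege1.
lra.
Qed.

Variables (k t : nat) (i : t.-tuple nat).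
Hypotheses (k0 : (0 < k)%N) (tk : (t <= k)%N) (si : sorted ltn i).
Hypothesis ik : forall j, (1 <= tnth i j <= k)%N.

Lemma normc_weyl_sum_perturbed (a a' : t.-tuple R) (b : (k - t).-tuple R)
    (N N' : nat) (r : R) :
  (0 < N)%N -> 0 <= r -> (N' <= 2 * N)%N ->
  (forall j, `|tnth a j - tnth a' j| <=
    perturbation k * r / N%:R ^+ tnth i j) ->
  normc (weyl_sum (assemble i a b) N'%:R - weyl_sum (assemble i a' b) N'%:R) <=
  r * N%:R / 4.
Proof.
move=> N0 r0 N'N aa'; apply: (le_trans (normc_weyl_sum_subr _ _ _)).
have kp := perturbation_gt0 k0.
have [li [lc [Eli Ea Eb li_lc]]] := assemble_coordinates (R := R) si ik.
(* Coordinates from [b] contribute nothing. For the others, [N' <= 2 * N] and [i_j <= k] give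
   [N' ^ i_j <= 2 ^ k * N ^ i_j], which cancels the denominator. *)
apply: (@le_trans _ _ (4 * pi * (2 * N%:R) *
    \sum_(l < k) perturbation k * r * 2 ^+ k)).
  apply: ler_pM.
  - by rewrite !mulr_ge0 ?pi_ge0.
  - by apply: sumr_ge0 => l _; rewrite mulr_ge0 ?exprn_ge0.
  - by rewrite ler_wpM2l ?mulr_ge0 ?pi_ge0// -natrM ler_nat.
  apply: ler_sum => l _; have [[j ->]|[j ->]] := li_lc l; last first.
    by rewrite !Eb subrr normr0 mul0r mulr_ge0 ?exprn_ge0 ?mulr_ge0 ?(ltW kp).
  have N1 : 0 < N%:R ^+ tnth i j :> R by rewrite exprn_gt0 ?ltr0n.
  rewrite !Ea Eli.
  apply: (@le_trans _ _ (perturbation k * r / N%:R ^+ tnth i j *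
      (2 ^+ k * N%:R ^+ tnth i j))).
    apply: ler_pM => //.
    apply: (@le_trans _ _ ((2 * N%:R) ^+ tnth i j)).
      by apply: lerXn2r; rewrite ?nnegrE ?mulr_ge0// -natrM ler_nat.
    rewrite exprMn ler_wpM2r ?exprn_ge0// ler_weXn2l ?ler1n//.
    by case/andP: (ik j).
  by rewrite [2 ^+ k * _]mulrC mulrA divfK// gt_eqF.
rewrite sumr_const card_ord -[X in _ * X]mulr_natr /perturbation.
rewrite le_eqVlt; apply/orP; left; apply/eqP.
move: (@pi R) (pi_gt0 R) => q q0; field.
by rewrite !gt_eqF ?ltr0n ?exprn_gt0.
Qed.

Lemma measurable_weyl_sum_fiber (b : (k - t).-tuple R) (N : nat) (p : R) :
  measurable_fun setT (fun a : t.-tuple mR =>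
    (normc (weyl_sum (assemble i a b) N%:R) `^ p)%:E).
Proof.
apply/measurable_EFinP; apply: measurableT_comp (measurable_powR p) _.
have := measurableT_comp (measurable_assemble (R := R) si ik)
  (measurable_pair1 (b : (k - t).-tuple mR)).
exact: measurableT_comp (measurable_normc_weyl_sum _).
Qed.

(* A large value of the sum at [(a, N)] persists on a box around [a] and for
   all lengths [N'] close to [N]. *)
Lemma fiber_moment_lower (a : t.-tuple R) (b : (k - t).-tuple R) (p H : R)
    (N N' : nat) :
  0 <= p -> (0 < N)%N -> unit_cube t a -> 0 < H ->
  H < normc (weyl_sum (assemble i a b) N%:R) ->
  (N <= N')%N -> N'%:R <= N%:R + H / 4 ->
  (((H / 2) `^ p *
    \prod_(j < t) (perturbation k * (H / N%:R) / N%:R ^+ tnth i j))%:E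
   <= fiber_moment i p b N')%E.
Proof.
move=> p0 N0 acube H0 HN NN' N'N.
have NR0 : 0 < N%:R :> R by rewrite ltr0n.
(* The trivial bound gives [H < N], hence [N' <= 2 * N] and [H / N <= 1]; the latter keeps the box
   sides at most 1/2. *)
have HltN : H < N%:R by apply: lt_le_trans HN (normc_weyl_sum_le _ _).
have N'2 : (N' <= 2 * N)%N by rewrite -(ler_nat R) natrM; lra.
pose eta j := perturbation k * (H / N%:R) / N%:R ^+ tnth i j.
have r0 : 0 < H / N%:R by rewrite divr_gt0.
have r1 : H / N%:R <= 1 by rewrite ler_pdivrMr// mul1r ltW.
have kp := perturbation_gt0 k0.
have eta0 j : 0 < eta j.
  by apply: divr_gt0; [exact: mulr_gt0|exact: exprn_gt0].
have eta2 j : eta j <= 2^-1.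
  apply: le_trans (perturbation_le k0).
  rewrite ler_pdivrMr ?exprn_gt0// ler_pM2l// (le_trans r1)//.
  by rewrite exprn_ege1// ler1n.
have /choice[c cP] j : exists c, 0 <= c /\ c + eta j <= 1 /\
    forall x, c <= x < c + eta j -> `|x - tnth a j| <= eta j.
  by apply: unit_subinterval; [exact: acube|rewrite eta0 eta2].
pose I j := `[c j, c j + eta j[%classic.
have Icube : tuple_box I `<=` unit_cube t.
  move=> v vI j; have [cj0 [cj1 _]] := cP j.
  by have := vI j; rewrite /I/= in_itv/= => /andP[]; lra.
have mI : measurable (tuple_box I : set (t.-tuple mR)).
  by apply: measurable_tuple_box => j; exact: measurable_itv.
have mf := measurable_weyl_sum_fiber b N' p.
apply: le_trans (ge0_subset_integral _ mI _ _ _ Icube); last 3 first.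
- exact: measurable_unit_cube.
- exact: measurable_funTS.
- by move=> x _; rewrite lee_fin powR_ge0.
apply: (@le_trans _ _
    (\int[lebesgue_tuple R t]_(x in tuple_box I) (cst ((H / 2) `^ p)%:E x))%E).
  rewrite integral_cst// EFinM lee_wpmul2l ?lee_fin ?powR_ge0//.
  have boxE := @lebesgue_tuple_boxE R t I (fun j => measurable_itv _).
  rewrite le_eqVlt; apply/orP; left; apply/eqP; symmetry; apply: etrans boxE _.
  rewrite -prodEFin; apply: eq_bigr => j _.
  rewrite lebesgue_measure_itv/= lte_fin ltrDl eta0.
  by rewrite -EFinD addrAC subrr add0r.
apply: ge0_le_integral => //.
- by move=> x _; rewrite lee_fin powR_ge0.
- exact: measurable_funTS.
have normc_ge0 (z : R[i]) : 0 <= normc z by case: z => x y; exact: sqrtr_ge0.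
move=> a' a'I; rewrite lee_fin; apply: ge0_ler_powR => //.
- by rewrite nnegrE divr_ge0// ltW.
- by rewrite nnegrE.
(* Passing from [N] to [N'] costs at most [H / 4], and from [a] to [a'] at most another [H / 4];
   more than [H / 2] remains. *)
have h1 := normc_weyl_sum_subl (assemble i a b) NN'.
have h2 : normc (weyl_sum (assemble i a' b) N'%:R -
    weyl_sum (assemble i a b) N'%:R) <= H / N%:R * N%:R / 4.
  apply: normc_weyl_sum_perturbed => //; first exact: ltW.
  move=> j; have [_ [_ cP3]] := cP j; apply: cP3.
  by have := a'I j; rewrite /I/= in_itv.
rewrite divfK ?gt_eqF// in h2.
set W := weyl_sum (assemble i a b) N%:R in HN h1.
set W1 := weyl_sum (assemble i a b) N'%:R in h1 h2.
set W2 := weyl_sum (assemble i a' b) N'%:R in h2 *.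
have normcC (z w : R[i]) : normc (z - w) = normc (w - z).
  by rewrite -opprB; exact: normcN.
have := normc_triangle (W - W1) W1; rewrite subrK normcC.
have := normc_triangle (W1 - W2) W2; rewrite subrK normcC.
lra.
Qed.

End block.

Lemma prod_powR (R : realType) (t : nat) (x : R) (f : 'I_t -> R) : 0 < x ->
  \prod_(j < t) x `^ f j = x `^ (\sum_(j < t) f j).
Proof.
move=> x0; apply: (big_ind2 (fun y z => y = x `^ z)) => [|y1 z1 y2 z2 -> ->|//].
  by rewrite powRr0.
by rewrite powRD// (gt_eqF x0) implybT.
Qed.

(** * The weighted series: finiteness from the mean value, lower bound from a large value *)

Section large_values.
Context {R : realType}.
Variables (k t : nat) (i : t.-tuple nat) (u eps : R).
Hypotheses (k0 : (0 < k)%N) (tk : (t <= k)%N) (si : sorted ltn i).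
Hypothesis ik : forall j, (1 <= tnth i j <= k)%N.
Hypotheses (u1 : 1 <= u) (t1 : (1 <= t)%N) (eps0 : 0 < eps).

Let u0 : 0 <= u. Proof. exact: le_trans u1. Qed.
Let D : R := 2^-1 + delta i u + eps.
(** Since [(2u + t + 1) delta = (t + 1) / 2 + sigma], the exponent [(2u + t + 1) D - t - sigma]
    equals [u + 1 + (2u + t + 1) eps]; this is [eps] minus that. *)
Let weight_exponent : R := - u - 1 - (2 * u + t%:R) * eps.
(** Index [n] stands for the length [n + 1], as in the series below. *)
Let weight (n : nat) : R := n.+1%:R `^ weight_exponent.
(** The factors come from the number of lengths, the weights at lengths up to [2 * N], the loss from
    [H] to [H / 2], and the [t] box sides. *)
Let constant : R :=
  4^-1 * 2 `^ weight_exponent * 2^-1 `^ (2 * u) * perturbation k ^+ t.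

Let weight_exponent_le0 : weight_exponent <= 0.
Proof.
have : 0 <= (2 * u + t%:R) * eps.
  by rewrite mulr_ge0 ?(ltW eps0)// addr_ge0// mulr_ge0.
by have := u0; rewrite /weight_exponent; move: (_ * eps) => x; lra.
Qed.

(* This identity is what determines [delta]. *)
Let exponent_identity :
  D + weight_exponent + D * (2 * u) +
    \sum_(j < t) (D - 1 - (tnth i j)%:R) = eps.
Proof.
have tR : 0 <= t%:R :> R by rewrite ler0n.
have nz : 4 * u + 2 * t%:R + 2 != 0 by rewrite gt_eqF//; have := u0; lra.
rewrite sumrB sumr_const card_ord -natr_sum -mulr_natr.
rewrite /D /weight_exponent /delta; field.
exact: nz.
Qed.

(** The mean value hypothesis is taken at [s = u], where the bound on [u] makes [X ^ u] the dominant
    term; the weights then leave at most a multiple of [n ^ (- 1 - eps)]. *)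
Lemma MC_weighted_series_fin : MC k u -> u <= (k * k.+1)%:R / 2 ->
  (\sum_(0 <= n <oo) (weight n)%:E *
    \int[lebesgue_tuple R k]_(alpha in unit_cube k)
      (normc (weyl_sum alpha n.+1%:R) `^ (2 * u))%:E < +oo)%E.
Proof.
move=> mc uk.
have [|C HC] := mc u _ eps eps0; first by rewrite u1 lexx.
have intpos n : (0 <= \int[lebesgue_tuple R k]_(alpha in unit_cube k)
      (normc (weyl_sum alpha n.+1%:R) `^ (2 * u))%:E)%E.
  by apply: integral_ge0 => a _; rewrite lee_fin powR_ge0.
have term_le n : ((weight n)%:E *
    \int[lebesgue_tuple R k]_(alpha in unit_cube k)
      (normc (weyl_sum alpha n.+1%:R) `^ (2 * u))%:E <=
    (2 * `|C| * n.+1%:R `^ (- 1 - eps))%:E)%E.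
  have n1 : 1 <= n.+1%:R :> R by rewrite ler1n.
  have n0 : 0 < n.+1%:R :> R by rewrite ltr0n.
  have powRM_n (x y : R) : n.+1%:R `^ x * n.+1%:R `^ y = n.+1%:R `^ (x + y).
    by rewrite powRD// (gt_eqF n0) implybT.
  apply: le_trans (lee_wpmul2l _ (HC _ n1)) _.
    by rewrite lee_fin powR_ge0.
  rewrite -EFinM lee_fin.
  have h : n.+1%:R `^ u + n.+1%:R `^ (2 * u - (k * k.+1)%:R / 2) <=
      2 * n.+1%:R `^ u.
    rewrite [leRHS]mulr_natl [leRHS]mulr2n lerD2l.
    apply: ler_powR => //; have := uk; lra.
  apply: (@le_trans _ _ (weight n *
      (`|C| * n.+1%:R `^ eps * (2 * n.+1%:R `^ u)))).
    apply: ler_wpM2l; first exact: powR_ge0.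
    apply: (@le_trans _ _ (`|C| * n.+1%:R `^ eps *
        (n.+1%:R `^ u + n.+1%:R `^ (2 * u - (k * k.+1)%:R / 2)))).
      rewrite ler_wpM2r ?addr_ge0 ?powR_ge0//.
      by rewrite ler_wpM2r ?powR_ge0// ler_norm.
    by rewrite ler_wpM2l// mulr_ge0// powR_ge0.
  rewrite (_ : weight n * _ = 2 * `|C| *
      n.+1%:R `^ (weight_exponent + eps + u)); last first.
    by rewrite -(powRM_n _ u) -(powRM_n _ eps) /weight; ring.
  rewrite ler_wpM2l ?mulr_ge0//; apply: ler_powR => //.
  rewrite /weight_exponent.
  (* The exponent reached is [- 1 - (2u + t - 1) eps], and [u] and [t] are at least 1. *)
  have : 0 <= (2 * (u - 1) + (t%:R - 1)) * eps.
    rewrite mulr_ge0 ?(ltW eps0)// addr_ge0 ?subr_ge0 ?ler1n// mulr_ge0//.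
    by rewrite subr_ge0.
  have := eps0; lra.
apply: (@le_lt_trans _ _ (2 * `|C| * (1 + eps^-1))%:E); last by rewrite ltry.
apply: lime_le.
  apply: is_cvg_nneseries => n _ _.
  by rewrite mule_ge0// lee_fin powR_ge0.
apply: nearW => n; apply: (@le_trans _ _ (\sum_(0 <= m < n)
    (2 * `|C| * m.+1%:R `^ (- 1 - eps))%:E)%E).
  by apply: lee_sum => m _; exact: term_le.
rewrite sumEFin lee_fin -mulr_sumr ler_wpM2l ?mulr_ge0//.
exact: powR_series_le.
Qed.

(** More than [N ^ D / 4] lengths just above [N] inherit the large value, and each contributes at
    least the same amount [c]. *)
Lemma large_value_series (a : t.-tuple R) (b : (k - t).-tuple R) (N : nat) :
  (0 < N)%N -> unit_cube t a ->
  N%:R `^ D < normc (weyl_sum (assemble i a b) N%:R) ->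
  ((constant * N%:R `^ eps)%:E <=
   \sum_(0 <= n <oo) (weight n)%:E * fiber_moment i (2 * u) b n.+1)%E.
Proof.
move=> N0 acube HN.
have NR0 : 0 < N%:R :> R by rewrite ltr0n.
pose H : R := N%:R `^ D.
have H0 : 0 < H by rewrite powR_gt0.
have HltN : H < N%:R by apply: lt_le_trans HN (normc_weyl_sum_le _ _).
pose m := Num.truncn (H / 4).
have [mH Hm] : m%:R <= H / 4 /\ H / 4 < m.+1%:R.
  by apply/andP/truncn_itv; rewrite divr_ge0 ?ltW.
pose L := (H / 2) `^ (2 * u) *
  \prod_(j < t) (perturbation k * (H / N%:R) / N%:R ^+ tnth i j).
have L0 : 0 <= L.
  rewrite mulr_ge0 ?powR_ge0// prodr_ge0// => j _.
  apply: divr_ge0; last exact: exprn_ge0.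
  apply: mulr_ge0; first exact/ltW/perturbation_gt0.
  by apply: divr_ge0 => //; exact: ltW.
have wF0 n : (0 <= (weight n)%:E * fiber_moment i (2 * u) b n.+1)%E.
  by rewrite mule_ge0 ?lee_fin ?powR_ge0// fiber_moment_ge0.
(* The lengths used are at most [2 * N] and the weight exponent is not positive, so the first factor
   bounds the weights below; [L] bounds the moments. *)
pose c := (2 * N%:R) `^ weight_exponent * L.
have term_ge n : (N.-1 <= n < N + m)%N ->
    (c%:E <= (weight n)%:E * fiber_moment i (2 * u) b n.+1)%E.
  move=> /andP[Nn nNm].
  have NSn : (N <= n.+1)%N by rewrite -(prednK N0) ltnS.
  have nN : n.+1%:R <= N%:R + H / 4 by
    apply: (@le_trans _ _ (N + m)%:R); rewrite ?ler_nat// natrD lerD2l.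
  rewrite /c EFinM lee_pmul ?lee_fin ?powR_ge0//.
    by rewrite /weight powR_neg_le ?weight_exponent_le0//; lra.
  by apply: fiber_moment_lower acube H0 HN NSn nN => //; rewrite mulr_ge0.
apply: (@le_trans _ _ (\sum_(0 <= n < N + m)
    (weight n)%:E * fiber_moment i (2 * u) b n.+1)%E); last first.
  by apply: nneseries_lim_ge => n _ _; exact: wF0.
have NNm : (N.-1 <= N + m)%N by rewrite (leq_trans (leq_pred _))// leq_addr.
rewrite (big_cat_nat (n := N.-1))//=.
apply: (@le_trans _ _ (\sum_(N.-1 <= n < N + m)
    (weight n)%:E * fiber_moment i (2 * u) b n.+1)%E); last first.
  by rewrite leeDr// sume_ge0.
apply: (@le_trans _ _ (\sum_(N.-1 <= n < N + m) c%:E)%E); last first.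
  rewrite big_seq [leRHS]big_seq; apply: lee_sum => n.
  by rewrite mem_index_iota => /term_ge.
rewrite sumEFin lee_fin sumr_const_nat.
(* The indices from [N - 1] to [N + m - 1] are the lengths from [N] to [N + m]; their number [m + 1]
   exceeds [H / 4]. *)
have -> : (N + m - N.-1 = m.+1)%N by rewrite -{1}(prednK N0) addSnnS addKn.
have c0 : 0 <= c by rewrite mulr_ge0 ?powR_ge0.
rewrite -[leRHS]mulr_natl; apply: (@le_trans _ _ (H / 4 * c)); last first.
  by rewrite ler_wpM2r// ltW.
have powRM_N (x y : R) : N%:R `^ x * N%:R `^ y = N%:R `^ (x + y).
  by rewrite powRD// (gt_eqF NR0) implybT.
have LE : L = 2^-1 `^ (2 * u) * perturbation k ^+ t *
    (N%:R `^ (D * (2 * u)) * N%:R `^ (\sum_(j < t) (D - 1 - (tnth i j)%:R))).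
  rewrite /L powRM ?invr_ge0 ?(ltW H0)// /H -powRrM.
  rewrite (eq_bigr (fun j => perturbation k * N%:R `^ (D - 1 - (tnth i j)%:R))).
    rewrite big_split/= prod_powR// prodr_const card_ord; ring.
  move=> j _; rewrite -mulrA; congr (_ * _).
  rewrite -!powRM_N powR_inv1 ?(ltW NR0)// powRN powR_mulrn// ltW.
(* Equality holds here: the powers of [N] from the count, the weight, the moment and the box combine
   by [exponent_identity]. *)
rewrite le_eqVlt; apply/orP; left; apply/eqP.
rewrite /c LE powRM// -[in LHS]exponent_identity.
rewrite -(powRM_N _ (\sum_j _)) -(powRM_N _ (D * (2 * u))) -(powRM_N D).
by rewrite /constant /H; ring.
Qed.

End large_values.

(** * The exceptional null set and the passage to real [X] *)

Theorem theorem1p1 (R : realType) (k : nat) (u : R) (t : nat)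
    (i : t.-tuple nat) :
  (3 <= k)%N ->
  1 <= u <= (k * k.+1)%:R / 2 ->
  MC k u ->
  (1 <= t <= k)%N ->
  sorted ltn i ->
  (forall j : 'I_t, 1 <= tnth i j <= k)%N ->
  exists B : set ((k - t).-tuple R),
    [/\ B `<=` unit_cube (k - t),
        (lebesgue_tuple R (k - t)).-negligible (unit_cube (k - t) `\` B)
      & forall b : (k - t).-tuple R, B b ->
        forall eps : R, 0 < eps ->
        \forall X \near +oo,
          sup [set normc (weyl_sum (assemble i a b) X) | a in unit_cube t]
            <= X `^ (2^-1 + delta i u + eps)].
Proof.
move=> k3 /andP[u1 uk] mc /andP[t1 tk] si ik.
have k0 : (0 < k)%N by exact: leq_trans k3.
(* A countable sequence tending to 0 lets one null set serve every [eps]. *)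
pose epsn (n : nat) : R := n.+1%:R^-1.
have epsn0 n : 0 < epsn n by rewrite invr_gt0 ltr0n.
pose G n (b : (k - t).-tuple R) := (\sum_(0 <= m <oo)
  (m.+1%:R `^ (- u - 1 - (2 * u + t%:R) * epsn n))%:E *
    fiber_moment i (2 * u) b m.+1)%E.
exists (unit_cube (k - t) `&` [set b | forall n, (G n b < +oo)%E]); split.
- by move=> b [].
- have null : (lebesgue_tuple R (k - t)).-negligible (\bigcup_n
      (unit_cube (k - t) `\` [set b | (G n b < +oo)%E])).
    apply: negligible_bigcup => n.
    apply: negligible_infinite_fiber_series => //.
    exact: MC_weighted_series_fin.
  apply: negligibleS null => b [bcube /not_andP[//|/existsNP[n Gn]]].
  by exists n.
move=> b [bcube Gfin] eps eps0.
have [n neps] : exists n, epsn n <= eps.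
  exists (Num.truncn eps^-1); rewrite /epsn -[leRHS]invrK.
  rewrite lef_pV2 ?posrE ?invr_gt0 ?ltr0n//.
  exact/ltW/truncnS_gt.
(* Nonnegativity makes the power monotone in its base, for the comparison of [N] with [X] below. *)
have D0 : 0 <= 2^-1 + delta i u + epsn n.
  have d0 : 0 <= delta i u.
    rewrite divr_ge0// ?addr_ge0 ?mulr_ge0//; lra.
  by rewrite !addr_ge0 ?invr_ge0// ltW.
(* This is the [constant] of [large_value_series] at [epsn n]. *)
pose c := 4^-1 * 2 `^ (- u - 1 - (2 * u + t%:R) * epsn n) *
  2^-1 `^ (2 * u) * perturbation k ^+ t : R.
have c0 : 0 < c by rewrite !mulr_gt0 ?powR_gt0 ?exprn_gt0 ?perturbation_gt0.
have Gpos : (0 <= G n b)%E.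
  apply: nneseries_ge0 => m _ _.
  by rewrite mule_ge0 ?fiber_moment_ge0// lee_fin powR_ge0.
have Gfn : G n b \is a fin_num by rewrite ge0_fin_numE.
(* Chosen so that [c * M ^ epsn n] is the value of the series; a large value at a length [N > M]
   would exceed it. *)
pose M := (fine (G n b) / c) `^ (epsn n)^-1.
near=> X.
have X1 : 1 <= X by near: X; exact: nbhs_pinfty_ge.
have XM : M + 1 <= X by near: X; apply: nbhs_pinfty_ge; rewrite num_real.
have [NX XN] : (Num.truncn X)%:R <= X /\ X < (Num.truncn X).+1%:R.
  by apply/andP/truncn_itv; lra.
set N := Num.truncn X in NX XN.
have N0 : (0 < N)%N by rewrite truncn_gt0.
have NR0 : 0 < N%:R :> R by rewrite ltr0n.
have MN : M < N%:R by rewrite -natr1 in XN; lra.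
apply: (@le_trans _ _ (X `^ (2^-1 + delta i u + epsn n))); last first.
  by apply: ler_powR => //; rewrite lerD2l.
(* The upper bound for [sup] asks for a nonempty set; the zero tuple provides an element. *)
apply: ge_sup.
  by exists (normc (weyl_sum (assemble i [tuple 0 | j < t] b) X));
    exists [tuple 0 | j < t] => // j; rewrite tnth_mktuple lexx ltr01.
move=> _ [a acube <-]; rewrite leNgt; apply/negP => HX.
(* The sum depends only on the integer part [N] of [X], and [N <= X], so a large value at [X] is one
   at [N]. *)
have HN : N%:R `^ (2^-1 + delta i u + epsn n) <
    normc (weyl_sum (assemble i a b) N%:R).
  rewrite -weyl_sum_truncn; apply: le_lt_trans HX.
  by rewrite ge0_ler_powR ?nnegrE// ltW// (lt_le_trans ltr01).
have := large_value_series k0 si ik u1 (epsn0 n) N0 acube HN.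
rewrite -/(G n b) -(fineK Gfn) lee_fin -/c leNgt => /negP; apply.
rewrite mulrC -ltr_pdivrMr//.
have -> : fine (G n b) / c = M `^ epsn n.
  rewrite /M -powRrM mulVf ?(gt_eqF (epsn0 n))// powRr1//.
  by apply: divr_ge0; [exact: fine_ge0|exact: ltW].
by rewrite gt0_ltr_powR ?nnegrE ?powR_ge0 ?(ltW NR0).
Unshelve. all: by end_near.
Qed.
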